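(* Let $(A,\cdot_A,\circ_A)$ be an anti-pre-Lie Poisson algebra and let $(A^*,\cdot_{A^*},\circ_{A^*})$ be an anti-pre-Lie Poisson algebra structure on the dual space $A^*$; let $(A,\cdot_A,[-,-]_A)$ and $(A^*,\cdot_{A^*},[-,-]_{A^*})$ be their sub-adjacent transposed Poisson algebras. Then the following conditions are equivalent: (1) There is a Manin triple of transposed Poisson algebras $\big((A\oplus A^*,\cdot,[-,-],\mathcal B_d),A,A^*\big)$ such that the compatible anti-pre-Lie Poisson algebra $(A\oplus A^*,\cdot,\circ)$, in which $\circ$ is defined by $\mathcal B_d(u\circ v,w)=\mathcal B_d(v,[u,w])$ for all $u,v,w\in A\oplus A^*$, contains $(A,\cdot_A,\circ_A)$ and $(A^*,\cdot_{A^*},\circ_{A^*})$ as anti-pre-Lie Poisson subalgebras. (2) $(A,A^*,-\mathcal L^*_{\cdot_A},-\mathrm{ad}_A^*,\mathcal R^*_{\circ_A},-\mathcal L^*_{\cdot_{A^*}},-\mathrm{ad}^*_{A^*},\mathcal R^*_{\circ_{A^*}})$ is a matched pair of anti-pre-Lie Poisson algebras. (3) $(A,A^*,-\mathcal L^*_{\cdot_A},-\mathcal L^*_{\circ_A},-\mathcal L^*_{\cdot_{A^*}},-\mathcal L^*_{\circ_{A^*}})$ is a matched pair of transposed Poisson algebras.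
   Context: All vector spaces and algebras are finite-dimensional over an algebraically closed field $\mathbb K$ of characteristic zero. Transposed Poisson algebra $(A,\cdot,[-,-])$: $(A,\cdot)$ commutative associative, $(A,[-,-])$ Lie, and $2z\cdot[x,y]=[z\cdot x,y]+[x,z\cdot y]$. Anti-pre-Lie algebra $(A,\circ)$: with $[x,y]=x\circ y-y\circ x$, $x\circ(y\circ z)-y\circ(x\circ z)=[y,x]\circ z$ and $[x,y]\circ z+[y,z]\circ x+[z,x]\circ y=0$; then $[-,-]$ is a Lie bracket (the sub-adjacent Lie algebra). Anti-pre-Lie Poisson algebra $(A,\cdot,\circ)$: $(A,\cdot)$ commutative associative, $(A,\circ)$ anti-pre-Lie, $2(x\circ y)\cdot z-2(y\circ x)\cdot z=y\cdot(x\circ z)-x\cdot(y\circ z)$ and $2x\circ(y\cdot z)=(z\cdot x)\circ y+z\cdot(x\circ y)$. Then $(A,\cdot,[-,-])$ is a transposed Poisson algebra, called sub-adjacent to $(A,\cdot,\circ)$, and $(A,\cdot,\circ)$ is called compatible with it. Notation: $\mathcal L_\cdot(x)y=x\cdot y$, $\mathcal L_\circ(x)y=x\circ y=\mathcal R_\circ(y)x$, $\mathrm{ad}(x)y=[x,y]$; for linear $\rho:A\to\mathrm{End}(V)$, $\langle\rho^*(x)u^*,v\rangle=-\langle u^*,\rho(x)v\rangle$. Manin triple of transposed Poisson algebras $((A\oplus A^*,\cdot,[-,-],\mathcal B_d),A,A^* )$: transposed Poisson algebra structures on $A$, $A^*$, $A\oplus A^*$ such that $A$ and $A^*$ are transposed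 Poisson subalgebras of $A\oplus A^*$, and the form $\mathcal B_d(x+a^*,y+b^* )=\langle x,b^*\rangle+\langle a^*,y\rangle$ satisfies $\mathcal B_d(u\cdot v,w)=\mathcal B_d(u,v\cdot w)$ and $\mathcal B_d([u,v],w)+\mathcal B_d([v,w],u)+\mathcal B_d([w,u],v)=0$ for all $u,v,w\in A\oplus A^*$. It is known that then the operation $\circ$ determined by $\mathcal B_d(u\circ v,w)=\mathcal B_d(v,[u,w])$ makes $(A\oplus A^*,\cdot,\circ)$ a compatible anti-pre-Lie Poisson algebra. Matched pair of commutative associative algebras $(A,B,\mu_A,\mu_B)$: $\mu_A:A\to\mathrm{End}(B)$, $\mu_B:B\to\mathrm{End}(A)$ are representations (multiplicative linear maps) with $\mu_A(x)(a\cdot_Bb)=(\mu_A(x)a)\cdot_Bb+\mu_A(\mu_B(a)x)b$ and $\mu_B(a)(x\cdot_Ay)=(\mu_B(a)x)\cdot_Ay+\mu_B(\mu_A(x)a)y$. Matched pair of Lie algebras $(A,B,\rho_A,\rho_B)$: $\rho_A:A\to\mathfrak{gl}(B)$, $\rho_B:B\to\mathfrak{gl}(A)$ are representations with $\rho_A(x)[a,b]_B-[\rho_A(x)a,b]_B-[a,\rho_A(x)b]_B+\rho_A(\rho_B(a)x)b-\rho_A(\rho_B(b)x)a=0$ and $\rho_B(a)[x,y]_A-[\rho_B(a)x,y]_A-[x,\rho_B(a)y]_A+\rho_B(\rho_A(x)a)y-\rho_B(\rho_A(y)a)x=0$. Representation $(\mu,\rho,V)$ of a transposed Poisson algebra: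 $\mu$ a representation of $(A,\cdot)$, $\rho$ of $(A,[-,-])$, $2\mu(x)\rho(y)=\rho(x\cdot y)+\rho(y)\mu(x)$, $2\mu([x,y])=\rho(x)\mu(y)-\rho(y)\mu(x)$. Matched pair of transposed Poisson algebras $(A,B,\mu_A,\rho_A,\mu_B,\rho_B)$: $(A,B,\mu_A,\mu_B)$ and $(A,B,\rho_A,\rho_B)$ are matched pairs of commutative associative and of Lie algebras; $(\mu_A,\rho_A,B)$, $(\mu_B,\rho_B,A)$ are representations of the transposed Poisson algebras $A$, $B$; and for all $x,y\in A$, $a,b\in B$: $2\mu_B(\rho_A(y)a)x-2x\cdot_A\rho_B(a)y=-\rho_B(a)(x\cdot_Ay)-\rho_B(\mu_A(x)a)y+[y,\mu_B(a)x]_A$; $2\mu_B(a)([x,y]_A)=[\mu_B(a)x,y]_A+\rho_B(\mu_A(x)a)y+[x,\mu_B(a)y]_A-\rho_B(\mu_A(y)a)x$; $2\mu_A(\rho_B(b)x)a-2a\cdot_B\rho_A(x)b=-\rho_A(x)(a\cdot_Bb)-\rho_A(\mu_B(a)x)b+[b,\mu_A(x)a]_B$; $2\mu_A(x)([a,b]_B)=[\mu_A(x)a,b]_B+\rho_A(\mu_B(a)x)b+[a,\mu_A(x)b]_B-\rho_A(\mu_B(b)x)a$. Representation $(l,r,V)$ of an anti-pre-Lie algebra: $l(y\circ x)-l(x\circ y)=l(x)l(y)-l(y)l(x)$; $r(x\circ y)=l(x)r(y)+r(y)l(x)-r(y)r(x)$; $l(y\circ x)-l(x\circ y)=r(x)l(y)-r(y)l(x)-r(x)r(y)+r(y)r(x)$.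 Matched pair of anti-pre-Lie algebras $(A,B,l_A,r_A,l_B,r_B)$: $(l_A,r_A,B)$, $(l_B,r_B,A)$ are representations of $(A,\circ_A)$, $(B,\circ_B)$, and for $x,y\in A$, $a\in B$: $r_B(l_A(y)a)x+x\circ_A r_B(a)y-r_B(l_A(x)a)y-y\circ_A r_B(a)x=r_B(a)([y,x]_A)$; $x\circ_A l_B(a)y+r_B(r_A(y)a)x-l_B(a)(x\circ_A y)=((l_B-r_B)(a)x)\circ_A y+l_B((r_A-l_A)(x)a)y$; $r_B(a)([x,y]_A)=((l_B-r_B)(a)y)\circ_A x+((r_B-l_B)(a)x)\circ_A y+l_B((r_A-l_A)(y)a)x+l_B((l_A-r_A)(x)a)y$; and the three equations obtained by exchanging the roles of $A$ and $B$. Representation $(\mu,l,r,V)$ of an anti-pre-Lie Poisson algebra: $\mu$ is a representation of $(A,\cdot)$, $(l,r,V)$ of $(A,\circ)$, and for all $x,y\in A$: $2\mu(y)l(x)-2\mu(y)r(x)=\mu(x\circ y)-\mu(x)r(y)$; $2\mu(x\circ y)-2\mu(y\circ x)=\mu(y)l(x)-\mu(x)l(y)$; $2r(x\cdot y)=r(y)\mu(x)+\mu(x)r(y)$; $2l(x)\mu(y)=l(x\cdot y)+\mu(y)l(x)$; $2l(x)\mu(y)=r(y)\mu(x)+\mu(x\circ y)$. Matched pair of anti-pre-Lie Poisson algebras $(A,B,\mu_A,l_A,r_A,\mu_B,l_B,r_B)$: $(A,B,\mu_A,\mu_B)$ and $(A,B,l_A,r_A,l_B,r_B)$ are matched pairs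 of commutative associative and of anti-pre-Lie algebras; $(\mu_A,l_A,r_A,B)$, $(\mu_B,l_B,r_B,A)$ are representations of the anti-pre-Lie Poisson algebras $A$, $B$; and for $x,y\in A$, $a\in B$: $2\mu_B(a)(x\circ_Ay)-2\mu_B(a)(y\circ_Ax)=\mu_B(l_A(x)a)y+y\cdot_Ar_B(a)x-\mu_B(l_A(y)a)x-x\cdot_Ar_B(a)y$; $2\mu_B((l_A-r_A)(x)a)y-2((l_B-r_B)(a)x)\cdot_Ay=\mu_B(a)(x\circ_Ay)-x\cdot_Al_B(a)y-\mu_B(r_A(y)a)x$; $2r_B(\mu_A(y)a)x+2x\circ_A\mu_B(a)y=(\mu_B(a)x)\circ_Ay+l_B(\mu_A(x)a)y+\mu_B(a)(x\circ_Ay)$; $2r_B(\mu_A(y)a)x+2x\circ_A\mu_B(a)y=r_B(a)(x\cdot_Ay)+\mu_B(l_A(x)a)y+y\cdot_Ar_B(a)x$; $2l_B(a)(x\cdot_Ay)=l_B(\mu_A(y)a)x+(\mu_B(a)y)\circ_Ax+y\cdot_Al_B(a)x+\mu_B(r_A(x)a)y$; and the five equations obtained by exchanging the roles of $A$ and $B$. *)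

(* Defs.v *)
From HB Require Import structures.
From mathcomp Require Import all_boot all_order all_algebra.

Set Implicit Arguments.
Unset Strict Implicit.
Unset Printing Implicit Defensive.

Import GRing.Theory.
Local Open Scope ring_scope.
Local Open Scope lfun_scope.

(* A linear map rho : A -> End(V).  A bilinear operation on A is encoded as
   [action A A], through its left multiplications: [m x y] is the product of x
   and y, so that m is itself the map L_m : A -> End(A). *)
Notation action A V := 'Hom(A, 'End(V)).

Section Operations.

Variable K : fieldType.

(* [linfun] is meaningful on linear functions only: this is the bilinear map
   defined by f when f is bilinear (see curry_lfunE). *)
Definition curry_lfun (U V W : vectType K) (f : U -> V -> W) :
    'Hom(U, 'Hom(V, W)) :=
  linfun (fun u => linfun (f u)).

Lemma curry_lfunE (U V W : vectType K) (f : U -> V -> W) :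
    (forall u, linear (f u)) -> (forall v, linear (f^~ v)) ->
  forall u v, curry_lfun f u v = f u v.
Proof.
move=> fr fl u v.
have E w : linfun (f w) =1 f w.
  pose g : {linear V -> W} := HB.pack (f w) (GRing.isLinear.Build _ _ _ _ _ (fr w)).
  by move=> t; rewrite -[f w]/(g : V -> W) lfunE.
have lin : linear (fun w => linfun (f w)).
  move=> k w1 w2; apply/lfunP => t.
  by rewrite add_lfunE scale_lfunE !E fl.
pose h : {linear U -> 'Hom(V, W)} :=
  HB.pack (fun w => linfun (f w)) (GRing.isLinear.Build _ _ _ _ _ lin).
by rewrite /curry_lfun -[fun w => linfun (f w)]/(h : U -> 'Hom(V, W)) lfunE /= E.
Qed.

Variable A : vectType K.

(* R_c(y) x = x o y *)
Definition rmult (c : action A A) : action A A := curry_lfun (fun y x => c x y).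

Lemma rmultE c y x : rmult c y x = c x y.
Proof.
by apply: curry_lfunE => [z|z] k u v; rewrite linearP ?add_lfunE ?scale_lfunE.
Qed.

(* [x, y] = x o y - y o x *)
Definition commutator (c : action A A) : action A A := c - rmult c.

Lemma commutatorE c x y : commutator c x y = c x y - c y x.
Proof. by rewrite /commutator add_lfunE opp_lfunE add_lfunE opp_lfunE rmultE. Qed.

End Operations.

Section Algebras.

Variables (K : fieldType) (A : vectType K).

Record comm_assoc_algebra (m : action A A) : Prop := {
  ca_comm : forall x y, m x y = m y x;
  ca_assoc : forall x y z, m (m x y) z = m x (m y z) }.

Record lie_algebra (b : action A A) : Prop := {
  lie_alt : forall x, b x x = 0;
  lie_jacobi : forall x y z, b x (b y z) + b y (b z x) + b z (b x y) = 0 }.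

Record transposed_Poisson (m b : action A A) : Prop := {
  tp_comm_assoc : comm_assoc_algebra m;
  tp_lie : lie_algebra b;
  tp_compat : forall x y z, m z (b x y) *+ 2 = b (m z x) y + b x (m z y) }.

Record anti_pre_Lie (c : action A A) : Prop := {
  apl_left : forall x y z,
    c x (c y z) - c y (c x z) = c (commutator c y x) z;
  apl_cyclic : forall x y z,
    c (commutator c x y) z + c (commutator c y z) x
      + c (commutator c z x) y = 0 }.

Record anti_pre_Lie_Poisson (m c : action A A) : Prop := {
  aplp_comm_assoc : comm_assoc_algebra m;
  aplp_anti_pre_Lie : anti_pre_Lie c;
  aplp_compat1 : forall x y z,
    m (c x y) z *+ 2 - m (c y x) z *+ 2 = m y (c x z) - m x (c y z);
  aplp_compat2 : forall x y z,
    c x (m y z) *+ 2 = c (m z x) y + m z (c x y) }.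

End Algebras.

Section Representations.

Variables (K : fieldType) (A V : vectType K).

Definition comm_assoc_rep (m : action A A) (mu : action A V) : Prop :=
  forall x y, mu (m x y) = mu x \o mu y.

Definition lie_rep (b : action A A) (rho : action A V) : Prop :=
  forall x y, rho (b x y) = (rho x \o rho y) - (rho y \o rho x).

Record transposed_Poisson_rep (m b : action A A) (mu rho : action A V) :
    Prop := {
  tpr_mu : comm_assoc_rep m mu;
  tpr_rho : lie_rep b rho;
  tpr_compat1 : forall x y,
    (mu x \o rho y) *+ 2 = rho (m x y) + (rho y \o mu x);
  tpr_compat2 : forall x y,
    mu (b x y) *+ 2 = (rho x \o mu y) - (rho y \o mu x) }.

Record anti_pre_Lie_rep (c : action A A) (l r : action A V) : Prop := {
  aplr1 : forall x y,
    l (c y x) - l (c x y) = (l x \o l y) - (l y \o l x);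
  aplr2 : forall x y,
    r (c x y) = (l x \o r y) + (r y \o l x) - (r y \o r x);
  aplr3 : forall x y,
    l (c y x) - l (c x y)
      = (r x \o l y) - (r y \o l x) - (r x \o r y) + (r y \o r x) }.

Record anti_pre_Lie_Poisson_rep (m c : action A A) (mu l r : action A V) :
    Prop := {
  aplpr_mu : comm_assoc_rep m mu;
  aplpr_lr : anti_pre_Lie_rep c l r;
  aplpr1 : forall x y,
    (mu y \o l x) *+ 2 - (mu y \o r x) *+ 2 = mu (c x y) - (mu x \o r y);
  aplpr2 : forall x y,
    mu (c x y) *+ 2 - mu (c y x) *+ 2 = (mu y \o l x) - (mu x \o l y);
  aplpr3 : forall x y,
    r (m x y) *+ 2 = (r y \o mu x) + (mu x \o r y);
  aplpr4 : forall x y,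
    (l x \o mu y) *+ 2 = l (m x y) + (mu y \o l x);
  aplpr5 : forall x y,
    (l x \o mu y) *+ 2 = (r y \o mu x) + mu (c x y) }.

End Representations.

(* Half of the mixed identities of a matched pair: those with values in A.
   The other half, with values in B, is obtained by exchanging A and B. *)
Section MatchedPairConditions.

Variables (K : fieldType) (A B : vectType K).

Definition comm_assoc_mixed (mA : action A A)
    (muA : action A B) (muB : action B A) : Prop :=
  forall (a : B) (x y : A),
    muB a (mA x y) = mA (muB a x) y + muB (muA x a) y.

Definition lie_mixed (bA : action A A)
    (rhoA : action A B) (rhoB : action B A) : Prop :=
  forall (a : B) (x y : A),
    rhoB a (bA x y) - bA (rhoB a x) y - bA x (rhoB a y)
      + rhoB (rhoA x a) y - rhoB (rhoA y a) x = 0.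

Record transposed_Poisson_mixed (mA bA : action A A)
    (muA rhoA : action A B) (muB rhoB : action B A) : Prop := {
  tpm1 : forall (x y : A) (a : B),
    muB (rhoA y a) x *+ 2 - mA x (rhoB a y) *+ 2
      = - rhoB a (mA x y) - rhoB (muA x a) y + bA y (muB a x);
  tpm2 : forall (x y : A) (a : B),
    muB a (bA x y) *+ 2
      = bA (muB a x) y + rhoB (muA x a) y
        + bA x (muB a y) - rhoB (muA y a) x }.

Record anti_pre_Lie_mixed (cA : action A A)
    (lA rA : action A B) (lB rB : action B A) : Prop := {
  aplm1 : forall (x y : A) (a : B),
    rB (lA y a) x + cA x (rB a y) - rB (lA x a) y - cA y (rB a x)
      = rB a (commutator cA y x);
  aplm2 : forall (x y : A) (a : B),
    cA x (lB a y) + rB (rA y a) x - lB a (cA x y)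
      = cA ((lB - rB) a x) y + lB ((rA - lA) x a) y;
  aplm3 : forall (x y : A) (a : B),
    rB a (commutator cA x y)
      = cA ((lB - rB) a y) x + cA ((rB - lB) a x) y
        + lB ((rA - lA) y a) x + lB ((lA - rA) x a) y }.

Record anti_pre_Lie_Poisson_mixed (mA cA : action A A)
    (muA lA rA : action A B) (muB lB rB : action B A) : Prop := {
  aplpm1 : forall (x y : A) (a : B),
    muB a (cA x y) *+ 2 - muB a (cA y x) *+ 2
      = muB (lA x a) y + mA y (rB a x) - muB (lA y a) x - mA x (rB a y);
  aplpm2 : forall (x y : A) (a : B),
    muB ((lA - rA) x a) y *+ 2 - mA ((lB - rB) a x) y *+ 2
      = muB a (cA x y) - mA x (lB a y) - muB (rA y a) x;
  aplpm3 : forall (x y : A) (a : B),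
    rB (muA y a) x *+ 2 + cA x (muB a y) *+ 2
      = cA (muB a x) y + lB (muA x a) y + muB a (cA x y);
  aplpm4 : forall (x y : A) (a : B),
    rB (muA y a) x *+ 2 + cA x (muB a y) *+ 2
      = rB a (mA x y) + muB (lA x a) y + mA y (rB a x);
  aplpm5 : forall (x y : A) (a : B),
    lB a (mA x y) *+ 2
      = lB (muA y a) x + cA (muB a y) x + mA y (lB a x) + muB (rA x a) y }.

End MatchedPairConditions.

Section MatchedPairs.

Variables (K : fieldType) (A B : vectType K).

Record comm_assoc_matched_pair (mA : action A A) (mB : action B B)
    (muA : action A B) (muB : action B A) : Prop := {
  camp_A : comm_assoc_algebra mA;
  camp_B : comm_assoc_algebra mB;
  camp_repA : comm_assoc_rep mA muA;
  camp_repB : comm_assoc_rep mB muB;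
  camp_mixedA : comm_assoc_mixed mA muA muB;
  camp_mixedB : comm_assoc_mixed mB muB muA }.

Record lie_matched_pair (bA : action A A) (bB : action B B)
    (rhoA : action A B) (rhoB : action B A) : Prop := {
  lmp_A : lie_algebra bA;
  lmp_B : lie_algebra bB;
  lmp_repA : lie_rep bA rhoA;
  lmp_repB : lie_rep bB rhoB;
  lmp_mixedA : lie_mixed bA rhoA rhoB;
  lmp_mixedB : lie_mixed bB rhoB rhoA }.

Record transposed_Poisson_matched_pair
    (mA bA : action A A) (mB bB : action B B)
    (muA rhoA : action A B) (muB rhoB : action B A) : Prop := {
  tpmp_A : transposed_Poisson mA bA;
  tpmp_B : transposed_Poisson mB bB;
  tpmp_mu : comm_assoc_matched_pair mA mB muA muB;
  tpmp_rho : lie_matched_pair bA bB rhoA rhoB;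
  tpmp_repA : transposed_Poisson_rep mA bA muA rhoA;
  tpmp_repB : transposed_Poisson_rep mB bB muB rhoB;
  tpmp_mixedA : transposed_Poisson_mixed mA bA muA rhoA muB rhoB;
  tpmp_mixedB : transposed_Poisson_mixed mB bB muB rhoB muA rhoA }.

Record anti_pre_Lie_matched_pair (cA : action A A) (cB : action B B)
    (lA rA : action A B) (lB rB : action B A) : Prop := {
  aplmp_A : anti_pre_Lie cA;
  aplmp_B : anti_pre_Lie cB;
  aplmp_repA : anti_pre_Lie_rep cA lA rA;
  aplmp_repB : anti_pre_Lie_rep cB lB rB;
  aplmp_mixedA : anti_pre_Lie_mixed cA lA rA lB rB;
  aplmp_mixedB : anti_pre_Lie_mixed cB lB rB lA rA }.

Record anti_pre_Lie_Poisson_matched_pair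
    (mA cA : action A A) (mB cB : action B B)
    (muA lA rA : action A B) (muB lB rB : action B A) : Prop := {
  aplpmp_A : anti_pre_Lie_Poisson mA cA;
  aplpmp_B : anti_pre_Lie_Poisson mB cB;
  aplpmp_mu : comm_assoc_matched_pair mA mB muA muB;
  aplpmp_lr : anti_pre_Lie_matched_pair cA cB lA rA lB rB;
  aplpmp_repA : anti_pre_Lie_Poisson_rep mA cA muA lA rA;
  aplpmp_repB : anti_pre_Lie_Poisson_rep mB cB muB lB rB;
  aplpmp_mixedA :
    anti_pre_Lie_Poisson_mixed mA cA muA lA rA muB lB rB;
  aplpmp_mixedB :
    anti_pre_Lie_Poisson_mixed mB cB muB lB rB muA lA rA }.

End MatchedPairs.

Section Duality.

Variables (K : fieldType) (V : vectType K).

Local Notation "V ^*" := 'Hom(V, K^o) (format "V ^*").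

(* <rho^*(x) u, v> = - <u, rho(x) v> *)
Definition dual_action (A : vectType K) (rho : action A V) : action A V^* :=
  curry_lfun (fun (x : A) (u : V^*) => - (u \o rho x)).

Lemma dual_actionE (A : vectType K) (rho : action A V) x (u : V^*) v :
  dual_action rho x u v = - u (rho x v).
Proof.
rewrite curry_lfunE ?opp_lfunE ?comp_lfunE // => [y|w] k s t; apply/lfunP => z.
  by rewrite !(opp_lfunE, add_lfunE, scale_lfunE, comp_lfunE) opprD scalerN.
rewrite !(opp_lfunE, add_lfunE, scale_lfunE, comp_lfunE) linearP.
by rewrite add_lfunE scale_lfunE linearD linearZ opprD scalerN.
Qed.

End Duality.

Section Predual.

Variables (K : fieldType) (V : vectType K).

Local Notation "V ^*" := 'Hom(V, K^o) (format "V ^*").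

Definition eval : 'Hom(V, 'Hom(V^*, K^o)) :=
  curry_lfun (fun (v : V) (u : V^*) => u v).

Lemma evalE v u : eval v u = u v.
Proof.
by apply: curry_lfunE => [w|w] k s t; rewrite ?linearP ?add_lfunE ?scale_lfunE.
Qed.

Lemma eval_inj : injective eval.
Proof.
move=> v w /lfunP E; rewrite (coord_vbasis (memvf v)) (coord_vbasis (memvf w)).
apply: eq_bigr => i _; congr (_ *: _).
pose f : {linear V -> K^o} := coord (vbasis fullv) i.
by have := E (linfun f); rewrite !evalE !lfunE.
Qed.

Lemma eval_limg : limg eval = fullv.
Proof.
apply/eqP; rewrite eqEdim subvf /= limg_dim_eq.
  have dimK : dim K^o = 1%N by [].
  have dimH (U : vectType K) : dim 'Hom(U, K^o) = dim U.
    by transitivity (dim U * dim K^o)%N; rewrite // dimK muln1.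
  by rewrite !dimvf !dimH.
by apply/eqP; rewrite capfv; apply/lker0P/eval_inj.
Qed.

(* The dual of an action on V^*, transported to V along the canonical
   isomorphism eval : V -> V^**. *)
Definition predual_action (B : vectType K) (rho : action B V^*) : action B V :=
  curry_lfun (fun (a : B) (v : V) => eval^-1 (dual_action rho a (eval v))).

Lemma predual_actionE (B : vectType K) (rho : action B V^*) a v (u : V^*) :
  u (predual_action rho a v) = - rho a u v.
Proof.
rewrite curry_lfunE => [|w|w]; last 2 first.
- by move=> k s t; rewrite !linearP.
- by move=> k s t; rewrite linearP add_lfunE scale_lfunE linearP.
rewrite -[LHS](evalE _ u) limg_lfunVK ?eval_limg ?memvf //.
by rewrite dual_actionE evalE.
Qed.

End Predual.

Section ManinTriples.

Variables (K : fieldType) (A : vectType K).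

Local Notation "V ^*" := 'Hom(V, K^o) (format "V ^*").
Local Notation D := (A * A^*)%type.

Definition inA (x : A) : D := (x, 0).
Definition inAdual (a : A^*) : D := (0, a).

Definition Bd (u v : D) : K := v.2 u.1 + u.2 v.1.

Record transposed_Poisson_Manin_triple (m b : action D D)
    (mA bA : action A A) (mA' bA' : action A^* A^*) : Prop := {
  manin_D : transposed_Poisson m b;
  manin_A : transposed_Poisson mA bA;
  manin_A' : transposed_Poisson mA' bA';
  manin_mA : forall x y, m (inA x) (inA y) = inA (mA x y);
  manin_bA : forall x y, b (inA x) (inA y) = inA (bA x y);
  manin_mA' : forall x y, m (inAdual x) (inAdual y) = inAdual (mA' x y);
  manin_bA' : forall x y, b (inAdual x) (inAdual y) = inAdual (bA' x y);
  manin_invariant : forall u v w, Bd (m u v) w = Bd u (m v w);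
  manin_cocycle : forall u v w,
    Bd (b u v) w + Bd (b v w) u + Bd (b w u) v = 0 }.

(* (D, m, c) is an anti-pre-Lie Poisson algebra compatible with (D, m, b), and
   c is determined by b through Bd. *)
Record Bd_compatible (m b c : action D D) : Prop := {
  Bdc_aplp : anti_pre_Lie_Poisson m c;
  Bdc_bracket : commutator c = b;
  Bdc_def : forall u v w, Bd (c u v) w = Bd v (b u w) }.

Definition contains_subalgebras (m c : action D D)
    (mA cA : action A A) (mA' cA' : action A^* A^*) : Prop :=
  [/\ forall x y, m (inA x) (inA y) = inA (mA x y),
      forall x y, c (inA x) (inA y) = inA (cA x y),
      forall x y, m (inAdual x) (inAdual y) = inAdual (mA' x y)
    & forall x y, c (inAdual x) (inAdual y) = inAdual (cA' x y)].

End ManinTriples.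

(* Main.v *)
(* On D = A + B the multiplications and actions define bicrossed products. An
   identity on D, split into its A- and B-component and restricted to pure
   arguments, is exactly a family of matched pair conditions; so (2) says that
   the double D of A and A^* is an anti-pre-Lie Poisson algebra, and (3) says
   that it is a transposed Poisson algebra. Invariance under Bd, together with
   the operations on A and on A^*, determines the operations on D, so (1) says
   the same as (2). Finally, both structures on D are equivalent: commutators of
   anti-pre-Lie Poisson algebras are transposed Poisson, and conversely the
   identities of (m, c) become those of (m, b) when tested against Bd. *)

Require Import Defs.
From mathcomp Require Import all_boot all_order all_algebra ring.

Set Implicit Arguments.
Unset Strict Implicit.
Unset Printing Implicit Defensive.

Import GRing.Theory.
Local Open Scope ring_scope.
Local Open Scope lfun_scope.

(** * Functionals, additivity of actions and proofs by linear combination *)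

Lemma functional_separation (K : fieldType) (V : vectType K) (v w : V) :
  (forall f : 'Hom(V, K^o), f v = f w) -> v = w.
Proof. by move=> E; apply: eval_inj; apply/lfunP=> f; rewrite !evalE. Qed.

Lemma mulrn_lfunE (K : fieldType) (U V : vectType K) (f : 'Hom(U, V)) n u :
  (f *+ n) u = f u *+ n.
Proof.
by elim: n => [|n IH]; rewrite ?mulr0n ?zero_lfunE // !mulrS add_lfunE IH.
Qed.

Section ActionMorphism.

Variables (K : fieldType) (A V : vectType K).
Implicit Types (f g : action A V) (x y : A) (v : V).

Lemma actionDl f x y v : f (x + y) v = f x v + f y v.
Proof. by rewrite linearD add_lfunE. Qed.

Lemma actionNl f x v : f (- x) v = - f x v.
Proof. by rewrite linearN opp_lfunE. Qed.

Lemma actionBl f x y v : f (x - y) v = f x v - f y v.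
Proof. by rewrite actionDl actionNl. Qed.

Lemma action0l f v : f 0 v = 0. Proof. by rewrite linear0 zero_lfunE. Qed.

Lemma action0r f x : f x 0 = 0. Proof. exact: linear0. Qed.

Lemma add_actionE f g x v : (f + g) x v = f x v + g x v.
Proof. by rewrite !add_lfunE. Qed.

Lemma opp_actionE f x v : (- f) x v = - f x v.
Proof. by rewrite !opp_lfunE. Qed.

Lemma sub_actionE f g x v : (f - g) x v = f x v - g x v.
Proof. by rewrite add_actionE opp_actionE. Qed.

End ActionMorphism.

(** The basis of all proofs by linear combination: [l = r] is assembled from known identities with
    [|+|], [|-|] and [@@], and the remaining equation between differences follows from additivity
    alone. *)
Lemma eq_by_difference (V : zmodType) (l r x y : V) :
  l = r -> x - y = l - r -> x = y.
Proof. by move=> -> /eqP; rewrite subrr subr_eq0 => /eqP. Qed.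

Lemma mulr2n_inj (K : fieldType) (V : vectType K) :
  [pchar K] =i pred0 -> injective (fun v : V => v *+ 2).
Proof.
move=> charK0 v w /eqP; rewrite -subr_eq0 -mulrnBl -scaler_nat scaler_eq0.
by rewrite ((pcharf0P K).1 charK0) subr_eq0 => /eqP.
Qed.

(* Vector identities become ring identities after applying a functional. *)
Ltac zmodule := apply: functional_separation => ?; ring.

Notation "E1 |+| E2" := (congr2 +%R E1 E2) (at level 50, left associativity).
Notation "|-| E" := (congr1 -%R E) (at level 35).
Notation "E1 |-| E2" := (congr2 +%R E1 (congr1 -%R E2))
  (at level 50, left associativity).
Notation "E @@ v" := (congr1 (fun f => fun_of_lfun f v) E)
  (at level 30).

(** * Components of products on A + B *)

Section Component.

Variables (K : fieldType) (A B : vectType K).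

(* The A-component of the product of (x, a) and (y, b) in A + B. *)
Definition component (p : action A A) (l r : action B A) (x : A) (a : B) y b :
    A :=
  p x y + l a y + r b x.

End Component.

Section ComponentExpansion.

Variables (K : fieldType) (A B : vectType K).
Variables (p p1 : action A A) (l r l1 r1 : action B A).
Variables (q1 : action B B) (l2 r2 : action A B).

Lemma component_subl x1 x2 a1 a2 y b :
  component p l r (x1 - x2) (a1 - a2) y b
    = component p l r x1 a1 y b - component p l r x2 a2 y b.
Proof. by rewrite /component !actionBl linearB /=; zmodule. Qed.

Lemma component_componentl x a y b z c :
  component p l r (component p1 l1 r1 x a y b) (component q1 l2 r2 a x b y) z c
    = p (p1 x y) z + p (l1 a y) z + p (r1 b x) z
      + (l (q1 a b) z + l (l2 x b) z + l (r2 y a) z)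
      + r c (component p1 l1 r1 x a y b).
Proof. by rewrite /component !actionDl. Qed.

Lemma component_componentr x a y b z c :
  component p l r x a (component p1 l1 r1 y b z c) (component q1 l2 r2 b y c z)
    = p x (component p1 l1 r1 y b z c) + l a (component p1 l1 r1 y b z c)
      + (r (q1 b c) x + r (l2 y c) x + r (r2 z b) x).
Proof. by rewrite /component !actionDl. Qed.

End ComponentExpansion.

(** Additivity in the first argument of an action is an equation between linear maps and is
    rewritten here; additivity in the second argument is left to [ring], which pushes linear maps
    through sums. *)
Ltac expand_actions :=
  rewrite ?sub_actionE ?add_actionE ?opp_actionE ?actionBl ?actionDl ?actionNl;
  do 2 rewrite ?add_lfunE ?opp_lfunE ?mulrn_lfunE ?comp_lfunE.

Ltac expand :=
  rewrite ?component_subl ?component_componentl ?component_componentr;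
  unfold component; expand_actions.

(** For identities at pure arguments, with zero entries. A product that vanishes leaves a new zero
    one level further out, hence several rounds. *)
Ltac expand0 :=
  unfold component; do 3 rewrite ?action0l ?action0r ?oppr0 ?add0r ?addr0;
  expand_actions.

Ltac lincomb E := apply: (eq_by_difference E); expand; zmodule.

Ltac lincomb0 E := apply: (eq_by_difference E); expand0; zmodule.

(** * Component identities against matched pair conditions *)

Section ComponentIdentities.

Variables (K : fieldType) (A B : vectType K).
Variables (mA bA cA : action A A) (mB bB cB : action B B).
Variables (muA rhoA lA rA : action A B) (muB rhoB lB rB : action B A).

Notation m1 := (component mA muB muB).
Notation m2 := (component mB muA muA).
Notation b1 := (component bA rhoB (- rhoB)).
Notation b2 := (component bB rhoA (- rhoA)).
Notation c1 := (component cA lB rB).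
Notation c2 := (component cB lA rA).

(** These are the A-components of the identities on A + B at the arguments [(x, a)], [(y, b)],
    [(z, c)]. The B-component of each is the same statement with A and B exchanged, so one proof
    serves both halves. *)
Definition component_assoc := forall x a y b z c,
  m1 (m1 x a y b) (m2 a x b y) z c = m1 x a (m1 y b z c) (m2 b y c z).

Definition component_jacobi := forall x a y b z c,
  b1 x a (b1 y b z c) (b2 b y c z) + b1 y b (b1 z c x a) (b2 c z a x)
    + b1 z c (b1 x a y b) (b2 a x b y) = 0.

Definition component_transposed_Poisson := forall x a y b z c,
  m1 z c (b1 x a y b) (b2 a x b y) *+ 2
    = b1 (m1 z c x a) (m2 c z a x) y b + b1 x a (m1 z c y b) (m2 c z b y).

Definition component_apl_left := forall x a y b z c,
  c1 x a (c1 y b z c) (c2 b y c z) - c1 y b (c1 x a z c) (c2 a x c z)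
    = c1 (c1 y b x a - c1 x a y b) (c2 b y a x - c2 a x b y) z c.

Definition component_apl_cyclic := forall x a y b z c,
  c1 (c1 x a y b - c1 y b x a) (c2 a x b y - c2 b y a x) z c
    + c1 (c1 y b z c - c1 z c y b) (c2 b y c z - c2 c z b y) x a
    + c1 (c1 z c x a - c1 x a z c) (c2 c z a x - c2 a x c z) y b = 0.

Definition component_aplp1 := forall x a y b z c,
  m1 (c1 x a y b) (c2 a x b y) z c *+ 2 - m1 (c1 y b x a) (c2 b y a x) z c *+ 2
    = m1 y b (c1 x a z c) (c2 a x c z) - m1 x a (c1 y b z c) (c2 b y c z).

Definition component_aplp2 := forall x a y b z c,
  c1 x a (m1 y b z c) (m2 b y c z) *+ 2
    = c1 (m1 z c x a) (m2 c z a x) y b + m1 z c (c1 x a y b) (c2 a x b y).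

(** The pattern of all lemmas of this section: evaluation at pure arguments yields the conditions,
    and conversely trilinearity makes the identity a sum of its pure cases. The case of three
    arguments in B has no A-component, which leaves seven cases; commutativity relates several of
    them here. *)
Lemma component_assocP : comm_assoc_algebra mA -> comm_assoc_algebra mB ->
  component_assoc <-> comm_assoc_rep mB muB /\ comm_assoc_mixed mA muA muB.
Proof.
move=> [commA assocA] [commB _]; split=> [H | [rep mix] x a y b z c].
  split=> [a b | a x y].
    by apply/lfunP=> z; lincomb0 (H 0 a 0 b z 0).
  lincomb0 (|-| H 0 a x 0 y 0).
(* The mixed identity with the action on the second factor, for the pure cases where the argument
   from B comes later. *)
have mixC w d t : muB d (mA t w) = mA t (muB d w) + muB (muA w d) t.
  by rewrite (commA t w) mix commA.
have repC d w : muB d (muB a w) = muB a (muB d w).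
  by have := rep a d; rewrite commB rep => /(fun E => E @@ w); expand.
rewrite /component (commB b c).
(* For the argument [b] in the middle place, both bracketings are equal to [muB b (mA x z)], one by
   [mix] and the other by [mixC]. *)
lincomb (assocA x y z |-| mix a y z |+| mixC y c x |-| mix b x z |+| mixC z b x
  |+| rep a b @@ z |-| rep c b @@ x |+| repC c y).
Qed.

Lemma component_jacobiP : lie_algebra bA -> (forall x y, bA y x = - bA x y) ->
  component_jacobi <-> lie_rep bB rhoB /\ lie_mixed bA rhoA rhoB.
Proof.
move=> [_ jacobiA] antiA; split=> [H | [rep mix] x a y b z c].
  split=> [a b | a x y].
    by apply/lfunP=> z; lincomb0 (|-| H 0 a 0 b z 0).
  apply: (eq_by_difference (H 0 a x 0 y 0)); expand0.
  rewrite (antiA y (rhoB a x)); zmodule.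
(* The cyclic sum contains [bA w (rhoB d t)], the mixed identity [bA (rhoB d t) w]. The sign is
   changed beforehand because [ring] does not know that [bA] is antisymmetric. *)
have mix' d t w : rhoB d (bA t w) + bA w (rhoB d t) - bA t (rhoB d w)
    + rhoB (rhoA t d) w - rhoB (rhoA w d) t = 0.
  by rewrite -[in RHS](mix d t w) (antiA w (rhoB d t)) opprK.
lincomb (jacobiA x y z |+| mix' a y z |+| mix' b z x |+| mix' c x y
  |-| rep a b @@ z |-| rep b c @@ x |-| rep c a @@ y).
Qed.

Lemma component_transposed_PoissonP : (forall x y, bA y x = - bA x y) ->
  component_transposed_Poisson <->
  [/\ forall x y z, mA z (bA x y) *+ 2 = bA (mA z x) y + bA x (mA z y),
   forall a b, (muB a \o rhoB b) *+ 2 = rhoB (mB a b) + (rhoB b \o muB a),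
   forall a b, muB (bB a b) *+ 2 = (rhoB a \o muB b) - (rhoB b \o muB a)
 & transposed_Poisson_mixed mA bA muA rhoA muB rhoB].
Proof.
move=> antiA; split=> [H | [compat rep1 rep2 [mix1 mix2]] x a y b z c].
  split=> [x y z | a b | a b |].
  - by lincomb0 (H x 0 y 0 z 0).
  - by apply/lfunP=> x; lincomb0 (|-| H x 0 0 b 0 a).
  - by apply/lfunP=> z; lincomb0 (H 0 a 0 b z 0).
  - split=> x y a; first lincomb0 (H y 0 0 a x 0).
    lincomb0 (H x 0 y 0 0 a).
have mix1' t w d : muB (rhoA w d) t *+ 2 - mA t (rhoB d w) *+ 2
    = - rhoB d (mA t w) - rhoB (muA t d) w - bA (muB d t) w.
  by rewrite mix1 (antiA (muB d t) w).
lincomb (compat x y z |+| rep1 c a @@ y |-| rep1 c b @@ x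
  |+| rep2 a b @@ z |-| mix1' z y a |+| mix1 z x b |+| mix2 x y c).
Qed.

(** Both sides change sign when [(x, a)] and [(y, b)] are exchanged, so five of the seven pure cases
    are left. The same happens in [component_aplp1P]. *)
Lemma component_apl_leftP :
  component_apl_left <->
  [/\ forall x y z, cA x (cA y z) - cA y (cA x z) = cA (cA y x - cA x y) z,
   forall a b, lB (cB b a) - lB (cB a b) = (lB a \o lB b) - (lB b \o lB a),
   forall a b, rB (cB a b) = (lB a \o rB b) + (rB b \o lB a) - (rB b \o rB a),
   forall x y a, rB (lA y a) x + cA x (rB a y) - rB (lA x a) y - cA y (rB a x)
      = rB a (cA y x - cA x y)
 & forall x y a, cA x (lB a y) + rB (rA y a) x - lB a (cA x y)
      = cA ((lB - rB) a x) y + lB ((rA - lA) x a) y].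
Proof.
split=> [H | [left rep1 rep2 mix1 mix2] x a y b z c].
  split=> [x y z | a b | a b | x y a | x y a].
  - by lincomb0 (H x 0 y 0 z 0).
  - by apply/lfunP=> x; lincomb0 (|-| H 0 a 0 b x 0).
  - by apply/lfunP=> x; lincomb0 (|-| H 0 a x 0 0 b).
  - by lincomb0 (H x 0 y 0 0 a).
  - by lincomb0 (H x 0 0 a y 0).
lincomb (left x y z |-| rep1 a b @@ z |-| rep2 a c @@ y |+| rep2 b c @@ x
  |+| mix1 x y c |+| mix2 x z b |-| mix2 y z a).
Qed.

(** Cyclic symmetry leaves three pure cases: no argument, one argument or two arguments in B. *)
Lemma component_apl_cyclicP :
  component_apl_cyclic <->
  [/\ forall x y z, cA (cA x y - cA y x) z + cA (cA y z - cA z y) x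
        + cA (cA z x - cA x z) y = 0,
   forall a b, lB (cB b a) - lB (cB a b)
      = (rB a \o lB b) - (rB b \o lB a) - (rB a \o rB b) + (rB b \o rB a)
 & forall x y a, rB a (cA x y - cA y x)
      = cA ((lB - rB) a y) x + cA ((rB - lB) a x) y
        + lB ((rA - lA) y a) x + lB ((lA - rA) x a) y].
Proof.
split=> [H | [cyclic rep mix] x a y b z c].
  split=> [x y z | a b | x y a].
  - by lincomb0 (H x 0 y 0 z 0).
  - by apply/lfunP=> x; lincomb0 (|-| H 0 a 0 b x 0).
  - by lincomb0 (H x 0 y 0 0 a).
lincomb (cyclic x y z |-| rep a b @@ z |-| rep b c @@ x |-| rep c a @@ y
  |+| mix x y c |+| mix y z a |+| mix z x b).
Qed.

Lemma component_aplp1P :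
  component_aplp1 <->
  [/\ forall x y z, mA (cA x y) z *+ 2 - mA (cA y x) z *+ 2
        = mA y (cA x z) - mA x (cA y z),
   forall a b,
      (muB b \o lB a) *+ 2 - (muB b \o rB a) *+ 2
        = muB (cB a b) - (muB a \o rB b),
   forall a b,
      muB (cB a b) *+ 2 - muB (cB b a) *+ 2 = (muB b \o lB a) - (muB a \o lB b),
   forall x y a, muB a (cA x y) *+ 2 - muB a (cA y x) *+ 2
      = muB (lA x a) y + mA y (rB a x) - muB (lA y a) x - mA x (rB a y)
 & forall x y a, muB ((lA - rA) x a) y *+ 2 - mA ((lB - rB) a x) y *+ 2
      = muB a (cA x y) - mA x (lB a y) - muB (rA y a) x].
Proof.
split=> [H | [compat rep1 rep2 mix1 mix2] x a y b z c].
  split=> [x y z | a b | a b | x y a | x y a].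
  - by lincomb0 (H x 0 y 0 z 0).
  - by apply/lfunP=> x; lincomb0 (|-| H x 0 0 a 0 b).
  - by apply/lfunP=> x; lincomb0 (H 0 a 0 b x 0).
  - by lincomb0 (H x 0 y 0 0 a).
  - by lincomb0 (H x 0 0 a y 0).
lincomb (compat x y z |+| rep1 a c @@ y |-| rep1 b c @@ x |+| rep2 a b @@ z
  |+| mix1 x y c |+| mix2 x z b |-| mix2 y z a).
Qed.

(** No symmetry relates the arguments, so each of the seven pure cases gives a condition of its
    own. *)
Lemma component_aplp2P : comm_assoc_algebra mA -> comm_assoc_algebra mB ->
  component_aplp2 <->
  [/\ forall x y z, cA x (mA y z) *+ 2 = cA (mA z x) y + mA z (cA x y),
  [/\ forall a b, rB (mB a b) *+ 2 = (rB b \o muB a) + (muB a \o rB b),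
      forall a b, (lB a \o muB b) *+ 2 = lB (mB a b) + (muB b \o lB a)
    & forall a b, (lB a \o muB b) *+ 2 = (rB b \o muB a) + muB (cB a b)]
 & [/\ forall x y a, rB (muA y a) x *+ 2 + cA x (muB a y) *+ 2
        = cA (muB a x) y + lB (muA x a) y + muB a (cA x y),
      forall x y a, rB (muA y a) x *+ 2 + cA x (muB a y) *+ 2
        = rB a (mA x y) + muB (lA x a) y + mA y (rB a x)
    & forall x y a, lB a (mA x y) *+ 2
        = lB (muA y a) x + cA (muB a y) x + mA y (lB a x) + muB (rA x a) y]].
Proof.
move=> [commA _] [commB _]; split=> [H | [compat reps mixs] x a y b z c].
  split=> [x y z | |]; first by lincomb0 (H x 0 y 0 z 0).
    split=> a b; apply/lfunP=> x.
    - by rewrite (commB a b); lincomb0 (H x 0 0 b 0 a).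
    - by rewrite (commB a b); lincomb0 (H 0 a x 0 0 b).
    - by lincomb0 (H 0 a 0 b x 0).
  split=> x y a.
  - by lincomb0 (H x 0 y 0 0 a).
  - by rewrite (commA x y); lincomb0 (H x 0 0 a y 0).
  - by lincomb0 (H 0 a x 0 y 0).
have [rep1 rep2 rep3] := reps; have [mix1 mix2 mix3] := mixs.
(* Commutativity of [mA] and [mB] is invisible to [ring], so the products are first brought into the
   order of the conditions. *)
rewrite /component (commA z x) (commB b c) (commB c a); expand.
apply: (eq_by_difference (compat x y z |+| rep1 c b @@ x |+| rep2 a c @@ y
  |+| rep3 a b @@ z |+| mix1 x y c |+| mix2 x z b |+| mix3 y z a)); expand.
rewrite (commA z x); zmodule.
Qed.

End ComponentIdentities.

Section ComponentLinear.

Variables (K : fieldType) (A B : vectType K).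

Lemma component_linearl (p : action A A) (l r : action B A) k x a x' a' y b :
  component p l r (k *: x + x') (k *: a + a') y b
    = k *: component p l r x a y b + component p l r x' a' y b.
Proof.
rewrite /component !linearP /= !add_lfunE !scale_lfunE !scalerDr.
zmodule.
Qed.

Lemma component_linearr (p : action A A) (l r : action B A) x a k y b y' b' :
  component p l r x a (k *: y + y') (k *: b + b')
    = k *: component p l r x a y b + component p l r x a y' b'.
Proof.
rewrite /component !linearP /= !add_lfunE !scale_lfunE !scalerDr.
zmodule.
Qed.

End ComponentLinear.

(** * Bicrossed products and matched pairs *)

Section Bicross.

Variables (K : fieldType) (A B : vectType K).
Local Notation D := (A * B)%type.

Definition bicross (p : action A A) (q : action B B) (l r : action A B)
    (l' r' : action B A) : action D D :=
  curry_lfun (fun u v : D =>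
    (component p l' r' u.1 u.2 v.1 v.2, component q l r u.2 u.1 v.2 v.1) : D).

Lemma bicrossE p q l r l' r' u v :
  bicross p q l r l' r' u v
    = (component p l' r' u.1 u.2 v.1 v.2, component q l r u.2 u.1 v.2 v.1).
Proof.
apply: curry_lfunE => w k s t.
  by congr pair; rewrite /= component_linearr.
by congr pair; rewrite /= component_linearl.
Qed.

(** Brackets on A + B are built with right actions opposite to the left ones. This is the shape that
    a commutator takes: both of its actions come from [l - r], up to sign. *)
Lemma commutator_bicross p q l r l' r' :
  commutator (bicross p q l r l' r')
  = bicross (commutator p) (commutator q) (l - r) (r - l) (l' - r') (r' - l').
Proof.
apply/lfunP => u; apply/lfunP => v; rewrite commutatorE !bicrossE.
congr pair; rewrite /component !commutatorE !sub_actionE /=; zmodule.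
Qed.

End Bicross.

Lemma lie_algebra_anti (K : fieldType) (A : vectType K) (b : action A A) :
  lie_algebra b -> forall x y, b y x = - b x y.
Proof.
move=> [alt _] x y; apply/eqP; rewrite -addr_eq0; apply/eqP.
have := alt (x + y); rewrite actionDl !linearD /= !alt add0r addr0 addrC.
by [].
Qed.

(** An identity of pairs is tested on each factor. For the second factor the entries of the pairs
    are named in the opposite order, which matches the component identity with A and B exchanged. *)
Ltac by_components :=
  split;
  [ intros H; split; intros x a y d z e;
    [ generalize (congr1 fst (H (x, a) (y, d) (z, e)))
    | generalize (congr1 snd (H (a, x) (d, y) (e, z))) ];
    rewrite ?commutatorE !bicrossE; exact id
  | intros [HA HB] [x a] [y d] [z e];
    rewrite ?commutatorE !bicrossE; congr pair;
    [exact (HA _ _ _ _ _ _) | exact (HB _ _ _ _ _ _)] ].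

Section MatchedPairs.

Variables (K : fieldType) (A B : vectType K).
Variables (mA bA cA : action A A) (mB bB cB : action B B).
Variables (muA rhoA lA rA : action A B) (muB rhoB lB rB : action B A).

Notation m := (bicross mA mB muA muA muB muB).
Notation b := (bicross bA bB rhoA (- rhoA) rhoB (- rhoB)).
Notation c := (bicross cA cB lA rA lB rB).

Lemma bicross_assocP :
  (forall u v w, m (m u v) w = m u (m v w)) <->
  component_assoc mA mB muA muB /\ component_assoc mB mA muB muA.
Proof. by_components. Qed.

Lemma bicross_jacobiP :
  (forall u v w, b u (b v w) + b v (b w u) + b w (b u v) = 0) <->
  component_jacobi bA bB rhoA rhoB /\ component_jacobi bB bA rhoB rhoA.
Proof. by_components. Qed.

Lemma bicross_transposed_PoissonP :
  (forall u v w, m w (b u v) *+ 2 = b (m w u) v + b u (m w v)) <->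
  component_transposed_Poisson mA bA mB bB muA rhoA muB rhoB /\
  component_transposed_Poisson mB bB mA bA muB rhoB muA rhoA.
Proof. by_components. Qed.

Lemma bicross_apl_leftP :
  (forall u v w, c u (c v w) - c v (c u w) = c (commutator c v u) w) <->
  component_apl_left cA cB lA rA lB rB /\ component_apl_left cB cA lB rB lA rA.
Proof. by_components. Qed.

Lemma bicross_apl_cyclicP :
  (forall u v w, c (commutator c u v) w + c (commutator c v w) u
     + c (commutator c w u) v = 0) <->
  component_apl_cyclic cA cB lA rA lB rB /\
  component_apl_cyclic cB cA lB rB lA rA.
Proof. by_components. Qed.

Lemma bicross_aplp1P :
  (forall u v w, m (c u v) w *+ 2 - m (c v u) w *+ 2
     = m v (c u w) - m u (c v w)) <->
  component_aplp1 mA cA cB lA rA muB lB rB /\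
  component_aplp1 mB cB cA lB rB muA lA rA.
Proof. by_components. Qed.

Lemma bicross_aplp2P :
  (forall u v w, c u (m v w) *+ 2 = c (m w u) v + m w (c u v)) <->
  component_aplp2 mA cA mB cB muA lA rA muB lB rB /\
  component_aplp2 mB cB mA cA muB lB rB muA lA rA.
Proof. by_components. Qed.

(** Left and right actions coincide in this product, so it is commutative as soon as [mA] and [mB]
    are; only associativity carries the matched pair conditions. *)
Lemma bicross_comm_assocP :
  comm_assoc_algebra mA -> comm_assoc_algebra mB ->
  comm_assoc_algebra m <-> comm_assoc_matched_pair mA mB muA muB.
Proof.
move=> algA algB.
have E1 := component_assocP muA muB algA algB.
have E2 := component_assocP muB muA algB algA.
split=> [[_ /bicross_assocP[/E1[repB mixA] /E2[repA mixB]]] //|].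
move=> [_ _ repA repB mixA mixB]; split=> [u v |]; last first.
  by apply/bicross_assocP; split; [apply/E1 | apply/E2].
by rewrite !bicrossE; congr pair; rewrite /component addrAC;
   congr (_ + _ + _); apply: ca_comm.
Qed.

(** The opposite right action makes the bracket alternating, so only the Jacobi identity carries the
    conditions. *)
Lemma bicross_lieP : lie_algebra bA -> lie_algebra bB ->
  lie_algebra b <-> lie_matched_pair bA bB rhoA rhoB.
Proof.
move=> algA algB.
have E1 := component_jacobiP bB rhoA rhoB algA (lie_algebra_anti algA).
have E2 := component_jacobiP bA rhoB rhoA algB (lie_algebra_anti algB).
split=> [[_ /bicross_jacobiP[/E1[repB mixA] /E2[repA mixB]]] //|].
move=> [_ _ repA repB mixA mixB]; split=> [u |]; last first.
  by apply/bicross_jacobiP; split; [apply/E1 | apply/E2].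
by rewrite bicrossE; congr pair; rewrite /component opp_actionE addrK lie_alt.
Qed.

Lemma bicross_tpP :
  transposed_Poisson mA bA -> transposed_Poisson mB bB ->
  transposed_Poisson m b <->
  transposed_Poisson_matched_pair mA bA mB bB muA rhoA muB rhoB.
Proof.
move=> algA algB; have [caA lieA compatA] := algA.
have [caB lieB compatB] := algB.
have E1 := component_transposed_PoissonP mA mB bB muA rhoA muB rhoB
  (lie_algebra_anti lieA).
have E2 := component_transposed_PoissonP mB mA bA muB rhoB muA rhoA
  (lie_algebra_anti lieB).
split.
  move=> [/(bicross_comm_assocP caA caB) camp /(bicross_lieP lieA lieB) lmp].
  move=> /bicross_transposed_PoissonP[/E1[_ rB1 rB2 mixA] /E2[_ rA1 rA2 mixB]].
  have [_ _ muArep muBrep _ _] := camp; have [_ _ rhoArep rhoBrep _ _] := lmp.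
  by split.
move=> [_ _ camp lmp [_ _ rA1 rA2] [_ _ rB1 rB2] mixA mixB]; split.
- exact/(bicross_comm_assocP caA caB).
- exact/(bicross_lieP lieA lieB).
- by apply/bicross_transposed_PoissonP; split; [apply/E1 | apply/E2].
Qed.

Lemma bicross_aplP : anti_pre_Lie cA -> anti_pre_Lie cB ->
  anti_pre_Lie c <-> anti_pre_Lie_matched_pair cA cB lA rA lB rB.
Proof.
move=> algA algB; have [leftA cycA] := algA; have [leftB cycB] := algB.
have leftA' x y z : cA x (cA y z) - cA y (cA x z) = cA (cA y x - cA x y) z.
  by rewrite leftA commutatorE.
have leftB' x y z : cB x (cB y z) - cB y (cB x z) = cB (cB y x - cB x y) z.
  by rewrite leftB commutatorE.
have cycA' x y z : cA (cA x y - cA y x) z + cA (cA y z - cA z y) x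
    + cA (cA z x - cA x z) y = 0.
  by rewrite -!commutatorE.
have cycB' x y z : cB (cB x y - cB y x) z + cB (cB y z - cB z y) x
    + cB (cB z x - cB x z) y = 0.
  by rewrite -!commutatorE.
have E1 := component_apl_leftP cA cB lA rA lB rB.
have E2 := component_apl_leftP cB cA lB rB lA rA.
have E3 := component_apl_cyclicP cA cB lA rA lB rB.
have E4 := component_apl_cyclicP cB cA lB rB lA rA.
split.
  move=> [/bicross_apl_leftP[/E1[_ lB1 lB2 mA1 mA2] /E2[_ lA1 lA2 mB1 mB2]]].
  move=> /bicross_apl_cyclicP[/E3[_ lB3 mA3] /E4[_ lA3 mB3]].
  by split=> //; split=> // x y a; rewrite commutatorE.
move=> [_ _ [lA1 lA2 lA3] [lB1 lB2 lB3] [mA1 mA2 mA3] [mB1 mB2 mB3]]; split.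
  apply/bicross_apl_leftP; split; [apply/E1 | apply/E2]; split=> // x y a;
    by rewrite -commutatorE.
apply/bicross_apl_cyclicP; split; [apply/E3 | apply/E4]; split=> // x y a;
  by rewrite -commutatorE.
Qed.

Lemma bicross_aplpP :
  anti_pre_Lie_Poisson mA cA -> anti_pre_Lie_Poisson mB cB ->
  anti_pre_Lie_Poisson m c <->
  anti_pre_Lie_Poisson_matched_pair mA cA mB cB muA lA rA muB lB rB.
Proof.
move=> algA algB; have [caA aplA compatA1 compatA2] := algA.
have [caB aplB compatB1 compatB2] := algB.
have E1 := component_aplp1P mA cA cB lA rA muB lB rB.
have E2 := component_aplp1P mB cB cA lB rB muA lA rA.
have E3 := component_aplp2P cA cB muA lA rA muB lB rB caA caB.
have E4 := component_aplp2P cB cA muB lB rB muA lA rA caB caA.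
split.
  move=> [/(bicross_comm_assocP caA caB) camp /(bicross_aplP aplA aplB) aplmp].
  move=> /bicross_aplp1P[/E1[_ rB1 rB2 mA1 mA2] /E2[_ rA1 rA2 mB1 mB2]].
  move=> /bicross_aplp2P[/E3[_ [rB3 rB4 rB5] [mA3 mA4 mA5]]].
  move=> /E4[_ [rA3 rA4 rA5] [mB3 mB4 mB5]].
  have [_ _ muArep muBrep _ _] := camp; have [_ _ lArep lBrep _ _] := aplmp.
  by split.
move=> [_ _ camp aplmp [_ _ rA1 rA2 rA3 rA4 rA5] [_ _ rB1 rB2 rB3 rB4 rB5]].
move=> [mA1 mA2 mA3 mA4 mA5] [mB1 mB2 mB3 mB4 mB5]; split.
- exact/(bicross_comm_assocP caA caB).
- exact/(bicross_aplP aplA aplB).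
- by apply/bicross_aplp1P; split; [apply/E1 | apply/E2].
- by apply/bicross_aplp2P; split; [apply/E3 | apply/E4].
Qed.

End MatchedPairs.

(** * Sub-adjacent transposed Poisson algebras *)

Lemma lie_derivation (K : fieldType) (A : vectType K) (b : action A A) :
  lie_algebra b -> forall x y z, b (b x y) z = b x (b y z) - b y (b x z).
Proof.
move=> lie x y z; have anti := lie_algebra_anti lie.
apply: (eq_by_difference (|-| lie_jacobi lie x y z)).
rewrite (anti (b x y) z) (anti x z) linearN /=; zmodule.
Qed.

Section SubAdjacent.

Variables (K : fieldType) (A : vectType K).
Variable c : action A A.

(** In the expanded Jacobi sum, the terms [c u (c v w) - c v (c u w)] become [- c (b u v) w] by
    hypothesis and double the terms [- c (b u v) w] already present. The formula is used in both
    directions: from the cyclic identity to Jacobi, and back when 2 is invertible. *)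
Lemma jacobi_commutator :
  (forall x y z, c x (c y z) - c y (c x z) = c (commutator c y x) z) ->
  forall x y z, let b := commutator c in
  b x (b y z) + b y (b z x) + b z (b x y)
    = - ((c (b x y) z + c (b y z) x + c (b z x) y) *+ 2).
Proof.
move=> left x y z /=.
have E : forall u v w, c u (c v w) - c v (c u w) + c (commutator c u v) w = 0.
  by move=> u v w; rewrite left !commutatorE !actionBl; zmodule.
move: (E x y z) (E y z x) (E z x y).
rewrite !commutatorE !actionBl => E1 E2 E3.
lincomb (E1 |+| E2 |+| E3).
Qed.

Lemma transposed_Poisson_commutator (m : action A A) :
  [pchar K] =i pred0 ->
  anti_pre_Lie_Poisson m c -> transposed_Poisson m (commutator c).
Proof.
move=> charK0 [ca [left cyclic] compat1 compat2].
have commA := ca_comm ca; split=> //.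
  split=> [x | x y z]; first by rewrite commutatorE subrr.
  by rewrite jacobi_commutator // cyclic mul0rn oppr0.
(* The goal is doubled because the known identities determine [x o (z y) - y o (z x)] only up to the
   factor 2. *)
move=> x y z; apply: (mulr2n_inj charK0).
have := compat1 x y z; have := compat2 y z x; have := compat2 y x z.
have := compat2 x z y; have := compat2 x y z.
rewrite (commA y z) (commA x z) (commA y x) !(commA _ z).
move=> EA EB EC ED E1; rewrite !commutatorE.
(* The second identity gives (z x) o y = 2 x o (z y) - z (x o y), hence
   [z x, y] + [x, z y] = 3 (x o (z y) - y o (z x)) - z [x, y]; it gives also
   2 (x o (z y) - y o (z x)) = y (x o z) - x (y o z), which is 2 z [x, y] by
   the first identity. *)
lincomb (EA |+| EA |-| EC |-| EC |+| E1 |+| E1 |+| E1 |-| EB |-| EB |-| EB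
  |+| ED |+| ED |+| ED).
Qed.

End SubAdjacent.

(** * Operations tested against an invariant form *)

Section InvariantForm.

Variables (K : fieldType) (E : vectType K) (form : E -> E -> K).
Hypothesis charK0 : [pchar K] =i pred0.
Hypothesis formC : forall u v, form u v = form v u.
Hypothesis formD : forall u v w, form (u + v) w = form u w + form v w.
Hypothesis form_nondegenerate :
  forall u v, (forall w, form u w = form v w) -> u = v.

Lemma formN u w : form (- u) w = - form u w.
Proof.
have form0 : form 0 w = 0.
  by apply: (addrI (form 0 w)); rewrite -formD !addr0.
by apply/eqP; rewrite -addr_eq0 -formD addNr form0.
Qed.

Lemma formMn u w n : form (u *+ n) w = form u w *+ n.
Proof.
elim: n => [|n IH]; last by rewrite !mulrS formD IH.
by rewrite !mulr0n -(subrr u) formD formN subrr.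
Qed.

Lemma formDr u v w : form u (v + w) = form u v + form u w.
Proof. by rewrite !(formC u) formD. Qed.

Lemma formNr u w : form u (- w) = - form u w.
Proof. by rewrite !(formC u) formN. Qed.

Lemma formMnr u w n : form u (w *+ n) = form u w *+ n.
Proof. by rewrite !(formC u) formMn. Qed.

Variables m b c : action E E.
Hypothesis invariant : forall u v w, form (m u v) w = form u (m v w).
Hypothesis form_c : forall u v w, form (c u v) w = form v (b u w).
Hypothesis commutator_c : commutator c = b.

(** Invariance and [form_c] move the operations onto the test vector [t]. The left identity then
    becomes Jacobi in derivation form, and both compatibilities become the single compatibility of
    [m] and [b]. The cyclic identity follows from Jacobi by [jacobi_commutator]. *)
Lemma anti_pre_Lie_Poisson_of_form :
  transposed_Poisson m b -> anti_pre_Lie_Poisson m c.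
Proof.
move=> [ca lie compat]; have antib := lie_algebra_anti lie.
have commA := ca_comm ca.
have left u v w : c u (c v w) - c v (c u w) = c (commutator c v u) w.
  rewrite commutator_c; apply: form_nondegenerate => t.
  by rewrite formD formN !form_c (lie_derivation lie) formDr formNr.
split=> //.
- split=> // u v w; apply: (mulr2n_inj charK0); rewrite /= mul0rn.
  apply: oppr_inj; rewrite oppr0 -jacobi_commutator // commutator_c.
  exact: (lie_jacobi lie).
- move=> u v w; apply: form_nondegenerate => t.
  rewrite -mulrnBl -actionBl -commutatorE commutator_c formMn formD formN.
  rewrite (commA _ w) (commA v) (commA u) !invariant !form_c (commA _ t).
  rewrite -formMnr compat -formNr -formDr addrC (commA t u) (commA t v).
  by rewrite (antib v (m u t)).
- move=> u v w; apply: form_nondegenerate => t.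
  rewrite formMn formD !form_c (commA v w) (commA w v) (commA w (c u v)).
  by rewrite !invariant !form_c -formMnr compat formDr.
Qed.

(** With the first bracket written as a commutator, its term is [form v (b u w) - form u (b v w)],
    which cancels the other two by symmetry of the form and antisymmetry of [b]. *)
Lemma form_cocycle : lie_algebra b -> forall u v w,
  form (b u v) w + form (b v w) u + form (b w u) v = 0.
Proof.
move=> lie u v w; have antib := lie_algebra_anti lie.
rewrite -{1}commutator_c commutatorE formD formN !form_c (antib u w).
by rewrite formN (formC (b v w) u) (formC (b u w) v) subrK subrr.
Qed.

End InvariantForm.

(** * The double of A and a space paired with it *)

Section DoubleOperations.

Variables (K : fieldType) (A B : semiVectType K).

(* For B the dual of A, the type of the operations on A * B exists in several
   convertible forms, which are slow to compare when unfolded: hence these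
   constants, with semivector structures as parameters. *)
Definition double_op : Type := 'Hom((A * B)%type, 'End((A * B)%type)).

Definition double_app (m : double_op) (u v : A * B) : A * B := m u v.

Record double_identities (form : A * B -> A * B -> K) (mA bA cA : A -> A -> A)
    (mB bB cB : B -> B -> B) (m b c : double_op) : Prop := {
  double_invariant : forall u v w,
    form (double_app m u v) w = form u (double_app m v w);
  double_cocycle : forall u v w, form (double_app b u v) w
    + form (double_app b v w) u + form (double_app b w u) v = 0;
  double_circ : forall u v w,
    form (double_app c u v) w = form v (double_app b u w);
  double_mA : forall x y, double_app m (x, 0) (y, 0) = (mA x y, 0);
  double_bA : forall x y, double_app b (x, 0) (y, 0) = (bA x y, 0);
  double_cA : forall x y, double_app c (x, 0) (y, 0) = (cA x y, 0);
  double_mB : forall a d, double_app m (0, a) (0, d) = (0, mB a d);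
  double_bB : forall a d, double_app b (0, a) (0, d) = (0, bB a d);
  double_cB : forall a d, double_app c (0, a) (0, d) = (0, cB a d) }.

End DoubleOperations.

Section DoubleStructure.

Variables (K : fieldType) (A B : vectType K) (form : A * B -> A * B -> K).
Variables (mA cA : action A A) (mB cB : action B B).

(** Condition (1) for an abstract partner B of A. That A and B are themselves transposed Poisson is
    left out, since their brackets are commutators of anti-pre-Lie Poisson algebras. *)
Definition double_structure : Prop :=
  exists m b c : double_op A B,
  [/\ transposed_Poisson m b, anti_pre_Lie_Poisson m c, commutator c = b
    & double_identities form (fun x => mA x) (fun x => commutator cA x)
        (fun x => cA x) (fun x => mB x) (fun x => commutator cB x)
        (fun x => cB x) m b c].

End DoubleStructure.

(* B is the dual of A, known only through the evaluation pairing pr. Then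
   (muA, lA, rA) and rhoA are the actions -L^*, -ad^*, R^* and -L_o^* of A on
   B, and likewise for B on A. *)
Section Double.

Variables (K : fieldType) (A B : vectType K) (pr : B -> A -> K).
Local Notation D := (A * B)%type.
Variable pairing_form : D -> D -> K.
Hypothesis pairing_formE :
  forall u v, pairing_form u v = pr v.2 u.1 + pr u.2 v.1.
Hypothesis charK0 : [pchar K] =i pred0.
Hypothesis prDl : forall a b x, pr (a + b) x = pr a x + pr b x.
Hypothesis prDr : forall a x y, pr a (x + y) = pr a x + pr a y.
Hypothesis pr_injl : forall a b, (forall x, pr a x = pr b x) -> a = b.
Hypothesis pr_injr : forall x y, (forall a, pr a x = pr a y) -> x = y.

Lemma pr0l x : pr 0 x = 0.
Proof. by apply: (addrI (pr 0 x)); rewrite -prDl !addr0. Qed.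

Lemma pr0r a : pr a 0 = 0.
Proof. by apply: (addrI (pr a 0)); rewrite -prDr !addr0. Qed.

Lemma prNl a x : pr (- a) x = - pr a x.
Proof. by apply/eqP; rewrite -addr_eq0 -prDl addNr pr0l. Qed.

Lemma prNr a x : pr a (- x) = - pr a x.
Proof. by apply/eqP; rewrite -addr_eq0 -prDr addNr pr0r. Qed.

Lemma pairing_formC u v : pairing_form u v = pairing_form v u.
Proof. by rewrite !pairing_formE addrC. Qed.

Lemma pairing_formD u v w :
  pairing_form (u + v) w = pairing_form u w + pairing_form v w.
Proof. by rewrite !pairing_formE prDr prDl addrACA. Qed.

Lemma pairing_form_nondegenerate u v :
  (forall w, pairing_form u w = pairing_form v w) -> u = v.
Proof.
case: u v => [x a] [y d] E; congr pair.
  apply: pr_injr => e; have := E (0, e).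
  by rewrite !pairing_formE !pr0r !addr0.
apply: pr_injl => z; have := E (z, 0).
by rewrite !pairing_formE !pr0l !add0r.
Qed.

Variables (mA cA : action A A) (mB cB : action B B).
Variables (muA lA rA : action A B) (muB lB rB : action B A).
Hypothesis pr_muA : forall x a y, pr (muA x a) y = pr a (mA x y).
Hypothesis pr_muB : forall b x a, pr a (muB b x) = pr (mB b a) x.
Hypothesis pr_lA : forall x a y, pr (lA x a) y = pr a (commutator cA x y).
Hypothesis pr_lB : forall b x a, pr a (lB b x) = pr (commutator cB b a) x.
Hypothesis pr_rA : forall x a y, pr (rA x a) y = - pr a (cA y x).
Hypothesis pr_rB : forall b x a, pr a (rB b x) = - pr (cB a b) x.

Variables (rhoA : action A B) (rhoB : action B A).
Hypothesis pr_rhoA : forall x a y, pr (rhoA x a) y = pr a (cA x y).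
Hypothesis pr_rhoB : forall b x a, pr a (rhoB b x) = pr (cB b a) x.

(** The transpose of [c x y = [x, y] + c y x], that is of left multiplication as ad plus right
    multiplication. It ties the actions of (3) to those of (2). *)
Lemma rhoA_sub : rhoA = lA - rA.
Proof.
apply/lfunP => x; apply/lfunP => a; apply: pr_injl => y.
rewrite sub_actionE prDl prNl pr_rhoA pr_lA pr_rA commutatorE prDr prNr.
by rewrite opprK subrK.
Qed.

Lemma rhoB_sub : rhoB = lB - rB.
Proof.
apply/lfunP => b; apply/lfunP => x; apply: pr_injr => a.
rewrite sub_actionE prDr prNr pr_rhoB pr_lB pr_rB commutatorE prDl prNl.
by rewrite opprK subrK.
Qed.

Notation bA := (commutator cA).
Notation bB := (commutator cB).
Notation m0 := (bicross mA mB muA muA muB muB).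
Notation c0 := (bicross cA cB lA rA lB rB).
Notation b0 := (bicross bA bB rhoA (- rhoA) rhoB (- rhoB)).

Lemma commutator_double : commutator c0 = b0.
Proof. by rewrite commutator_bicross rhoA_sub rhoB_sub !opprB. Qed.

(** Every term is an evaluation of a product inside A or inside B, so invariance of the form can be
    read off from commutativity of [mA] and [mB]. *)
Lemma pairing_form_mul u v w : pairing_form (m0 u v) w =
  pr w.2 (mA u.1 v.1) + pr (mB u.2 w.2) v.1 + pr (mB v.2 w.2) u.1
  + (pr (mB u.2 v.2) w.1 + pr v.2 (mA u.1 w.1) + pr u.2 (mA v.1 w.1)).
Proof.
by rewrite bicrossE !pairing_formE /= /component !prDr !prDl !pr_muA !pr_muB.
Qed.

Lemma pairing_form_circ u v w : pairing_form (c0 u v) w =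
  pr w.2 (cA u.1 v.1) + pr (bB u.2 w.2) v.1 - pr (cB w.2 v.2) u.1
  + (pr (cB u.2 v.2) w.1 + pr v.2 (bA u.1 w.1) - pr u.2 (cA w.1 v.1)).
Proof.
rewrite bicrossE !pairing_formE /= /component !prDr !prDl pr_lA pr_lB.
by rewrite pr_rA pr_rB.
Qed.

Lemma pairing_form_invariant :
  comm_assoc_algebra mA -> comm_assoc_algebra mB -> forall u v w,
  pairing_form (m0 u v) w = pairing_form u (m0 v w).
Proof.
move=> [commA _] [commB _] u v w.
rewrite (pairing_formC u) !pairing_form_mul.
rewrite (commA v.1 u.1) (commA w.1 u.1).
rewrite (commB v.2 u.2) (commB w.2 u.2); ring.
Qed.

Lemma pairing_form_circ_bracket u v w :
  pairing_form (c0 u v) w = pairing_form v (commutator c0 u w).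
Proof.
rewrite (pairing_formC v) commutatorE pairing_formD.
rewrite (formN pairing_formD) !pairing_form_circ !commutatorE.
rewrite !prDl !prNl !prDr !prNr; ring.
Qed.

Lemma pair_split (x : A) (a : B) : ((x, a) : D) = (x, 0) + (0, a).
Proof. by congr pair; rewrite /= ?addr0 ?add0r. Qed.

Lemma pairing_form_ext (u : D) x a :
    (forall y, pairing_form u (y, 0) = pr a y) ->
    (forall d, pairing_form u (0, d) = pr d x) ->
  u = (x, a).
Proof.
case: u => y d E1 E2; congr pair.
  by apply: pr_injr => e; rewrite -E2 pairing_formE /= pr0r addr0.
by apply: pr_injl => z; rewrite -E1 pairing_formE /= pr0l add0r.
Qed.

Lemma action_ext (f g : action D D) :
    (forall x y, f (x, 0) (y, 0) = g (x, 0) (y, 0)) ->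
    (forall x d, f (x, 0) (0, d) = g (x, 0) (0, d)) ->
    (forall a y, f (0, a) (y, 0) = g (0, a) (y, 0)) ->
    (forall a d, f (0, a) (0, d) = g (0, a) (0, d)) ->
  f = g.
Proof.
move=> E1 E2 E3 E4; apply/lfunP => -[x a]; apply/lfunP => -[y d].
rewrite (pair_split x a) (pair_split y d) !actionDl.
rewrite !(linearD (f _)) !(linearD (g _)) /=.
by rewrite E1 E2 E3 E4.
Qed.

Lemma bicross_AA p q (l r : action A B) (l' r' : action B A) x y :
  bicross p q l r l' r' (x, 0) (y, 0) = (p x y, 0).
Proof.
rewrite bicrossE; congr pair;
  by rewrite /component /= ?action0r ?action0l !addr0.
Qed.

Lemma bicross_BB p q (l r : action A B) (l' r' : action B A) a d :
  bicross p q l r l' r' (0, a) (0, d) = (0, q a d).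
Proof.
rewrite bicrossE; congr pair;
  by rewrite /component /= ?action0r ?action0l !addr0.
Qed.

Lemma bicross_AB p q (l r : action A B) (l' r' : action B A) x d :
  bicross p q l r l' r' (x, 0) (0, d) = (r' d x, l x d).
Proof.
rewrite bicrossE; congr pair;
  by rewrite /component /= ?action0r ?action0l ?addr0 ?add0r.
Qed.

Lemma bicross_BA p q (l r : action A B) (l' r' : action B A) a y :
  bicross p q l r l' r' (0, a) (y, 0) = (l' a y, r y a).
Proof.
rewrite bicrossE; congr pair;
  by rewrite /component /= ?action0r ?action0l ?addr0 ?add0r.
Qed.

Section Uniqueness.

Variables m b c : action D D.

(** A mixed product is known from its pairings with A and with B, and invariance turns each of these
    into a product inside A or inside B. *)
Lemma invariant_mul_unique :
    (forall u v, m u v = m v u) ->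
    (forall u v w, pairing_form (m u v) w = pairing_form u (m v w)) ->
    (forall x y, m (x, 0) (y, 0) = (mA x y, 0)) ->
    (forall a d, m (0, a) (0, d) = (0, mB a d)) ->
  m = m0.
Proof.
move=> comm inv mAE mBE.
have mABE x d : m (x, 0) (0, d) = (muB d x, muA x d).
  apply: pairing_form_ext => [y | e].
    by rewrite comm inv mAE !pairing_formE /= pr0l add0r pr_muA.
  by rewrite inv mBE !pairing_formE /= pr0l addr0 pr_muB.
apply: action_ext => [x y | x d | a y | a d].
- by rewrite mAE bicross_AA.
- by rewrite mABE bicross_AB.
- by rewrite comm mABE bicross_BA.
- by rewrite mBE bicross_BB.
Qed.

Lemma circ_unique :
    (forall u v, b u v = - b v u) ->
    (forall u v w, pairing_form (c u v) w = pairing_form v (b u w)) ->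
    (forall x y, b (x, 0) (y, 0) = (bA x y, 0)) ->
    (forall a d, b (0, a) (0, d) = (0, bB a d)) ->
    (forall x y, c (x, 0) (y, 0) = (cA x y, 0)) ->
    (forall a d, c (0, a) (0, d) = (0, cB a d)) ->
  c = c0.
Proof.
move=> anti circ bAE bBE cAE cBE.
(* Antisymmetry of [b] makes [pairing_form (c u v) w] antisymmetric in [u] and [w]. A test vector
   can thus replace the first factor, which gives the products inside A or B that determine the
   right actions. *)
have swap u v w : pairing_form (c u v) w = - pairing_form (c w v) u.
  by rewrite !circ anti (formNr pairing_formC pairing_formD).
apply: action_ext => [x y | x d | a y | a d].
- by rewrite cAE bicross_AA.
- rewrite bicross_AB; apply: pairing_form_ext => [y | e].
    by rewrite circ bAE !pairing_formE /= pr0l add0r pr_lA.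
  by rewrite swap cBE !pairing_formE /= pr0r add0r pr_rB.
- rewrite bicross_BA; apply: pairing_form_ext => [z | e].
    by rewrite swap cAE !pairing_formE /= pr0l addr0 pr_rA.
  by rewrite circ bBE !pairing_formE /= pr0l addr0 pr_lB.
- by rewrite cBE bicross_BB.
Qed.

End Uniqueness.

Hypothesis aplpA : anti_pre_Lie_Poisson mA cA.
Hypothesis aplpB : anti_pre_Lie_Poisson mB cB.

Let tpA := transposed_Poisson_commutator charK0 aplpA.
Let tpB := transposed_Poisson_commutator charK0 aplpB.

(** From left to right the commutator is taken; from right to left the nondegenerate form recovers
    the identities of [c0] from those of [b0]. *)
Lemma double_aplp_tp : anti_pre_Lie_Poisson m0 c0 <-> transposed_Poisson m0 b0.
Proof.
split=> [aplp | tp].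
  by rewrite -commutator_double; apply: transposed_Poisson_commutator.
have inv :=
  pairing_form_invariant (aplp_comm_assoc aplpA) (aplp_comm_assoc aplpB).
apply: (anti_pre_Lie_Poisson_of_form charK0 pairing_formC pairing_formD
          pairing_form_nondegenerate inv _ commutator_double tp) => u v w.
by rewrite pairing_form_circ_bracket commutator_double.
Qed.

Lemma aplp_matched_pair_tp_matched_pair :
  anti_pre_Lie_Poisson_matched_pair mA cA mB cB muA lA rA muB lB rB <->
  transposed_Poisson_matched_pair mA bA mB bB muA rhoA muB rhoB.
Proof.
have [P1 P2] := bicross_aplpP muA lA rA muB lB rB aplpA aplpB.
have [Q1 Q2] := bicross_tpP muA rhoA muB rhoB tpA tpB.
have [R1 R2] := double_aplp_tp.
by split=> [/P2/R1/Q1 | /Q2/R2/P1].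
Qed.

Lemma double_structure_matched_pair :
  double_structure pairing_form mA cA mB cB <->
  anti_pre_Lie_Poisson_matched_pair mA cA mB cB muA lA rA muB lB rB.
Proof.
split.
  intros [m [b [c [tp aplp _ ids]]]].
  apply/(bicross_aplpP muA lA rA muB lB rB aplpA aplpB).
  have anti u v := lie_algebra_anti (tp_lie tp) v u.
  (* By uniqueness [m0] and [c0] are the given operations [m] and [c], for which the claim is
     assumed. *)
  rewrite -(invariant_mul_unique (ca_comm (tp_comm_assoc tp))
    (double_invariant ids) (double_mA ids) (double_mB ids)).
  by rewrite -(circ_unique anti (double_circ ids) (double_bA ids)
    (double_bB ids) (double_cA ids) (double_cB ids)).
move=> /(bicross_aplpP muA lA rA muB lB rB aplpA aplpB) aplp.
have tp := double_aplp_tp.1 aplp.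
have circ u v w : pairing_form (c0 u v) w = pairing_form v (b0 u w).
  by rewrite pairing_form_circ_bracket commutator_double.
exists m0, b0, c0; split=> //; first exact: commutator_double.
split; try by move=> *; rewrite /double_app ?bicross_AA ?bicross_BB.
- exact: pairing_form_invariant (aplp_comm_assoc aplpA) (aplp_comm_assoc aplpB).
- exact: (form_cocycle pairing_formC pairing_formD circ commutator_double
            (tp_lie tp)).
Qed.

Lemma double_equivalences :
  (double_structure pairing_form mA cA mB cB <->
   anti_pre_Lie_Poisson_matched_pair mA cA mB cB muA lA rA muB lB rB) /\
  (anti_pre_Lie_Poisson_matched_pair mA cA mB cB muA lA rA muB lB rB <->
   transposed_Poisson_matched_pair mA bA mB bB muA rhoA muB rhoB).
Proof.
exact: conj double_structure_matched_pair aplp_matched_pair_tp_matched_pair.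
Qed.

End Double.

(** * The dual space as partner of A *)

Section Dual.

Variables (K : fieldType) (V A : vectType K).
Local Notation "V ^*" := 'Hom(V, K^o) (format "V ^*").

(** The outer sign cancels the one in the dual action: the actions [-L^*] and [-ad^*] are plain
    transposes. *)
Lemma opp_dualE (rho : action A V) x (u : V^*) v :
  (- dual_action rho) x u v = u (rho x v).
Proof. by rewrite opp_actionE opp_lfunE dual_actionE opprK. Qed.

Lemma opp_predualE (rho : action A V^*) a v (u : V^*) :
  u ((- predual_action rho) a v) = rho a u v.
Proof. by rewrite opp_actionE linearN /= predual_actionE opprK. Qed.

End Dual.

Section DualDouble.

Variables (K : fieldType) (A : vectType K).
Local Notation "V ^*" := 'Hom(V, K^o) (format "V ^*").
Variables (mA cA : action A A) (mA' cA' : action A^* A^*).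
Local Notation manin m b := (transposed_Poisson_Manin_triple m b
  mA (commutator cA) mA' (commutator cA')).
Local Notation double := (@double_structure K A A^* (@Bd K A) mA cA mA' cA').

Local Notation identities := (@double_identities K A A^* (@Bd K A)
  (fun x => mA x) (fun x => commutator cA x) (fun x => cA x)
  (fun x => mA' x) (fun x => commutator cA' x) (fun x => cA' x)).

(** The fields agree up to unfolding of [inA], [inAdual] and [double_app]; this lemma and the next
    ones only regroup them. *)
Lemma double_identities_of_Manin_triple (m b c : double_op A A^*) :
  manin m b -> Bd_compatible m b c ->
  contains_subalgebras m c mA cA mA' cA' -> identities m b c.
Proof.
move=> triple compat [_ cAE _ cBE].
split.
- exact: (manin_invariant triple).
- exact: (manin_cocycle triple).
- exact: (Bdc_def compat).
- exact: (manin_mA triple).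
- exact: (manin_bA triple).
- exact: cAE.
- exact: (manin_mA' triple).
- exact: (manin_bA' triple).
- exact: cBE.
Qed.

Lemma double_structure_of_Manin_triple (m b c : double_op A A^*) :
  manin m b -> Bd_compatible m b c ->
  contains_subalgebras m c mA cA mA' cA' -> double.
Proof.
move=> triple compat sub; exists m, b, c; split.
- exact: (manin_D triple).
- exact: (Bdc_aplp compat).
- exact: (Bdc_bracket compat).
- exact: double_identities_of_Manin_triple triple compat sub.
Qed.

Hypothesis charK0 : [pchar K] =i pred0.
Hypothesis aplpA : anti_pre_Lie_Poisson mA cA.
Hypothesis aplpA' : anti_pre_Lie_Poisson mA' cA'.

Lemma Manin_triple_of_double_identities (m b c : double_op A A^*) :
  transposed_Poisson m b -> identities m b c -> manin m b.
Proof.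
move=> tp ids; split.
- exact: tp.
- exact: transposed_Poisson_commutator charK0 aplpA.
- exact: transposed_Poisson_commutator charK0 aplpA'.
- exact: (double_mA ids).
- exact: (double_bA ids).
- exact: (double_mB ids).
- exact: (double_bB ids).
- exact: (double_invariant ids).
- exact: (double_cocycle ids).
Qed.

Lemma Bd_compatible_of_double_identities (m b c : double_op A A^*) :
  anti_pre_Lie_Poisson m c -> commutator c = b -> identities m b c ->
  Bd_compatible m b c.
Proof.
move=> aplp cb ids; split.
- exact: aplp.
- exact: cb.
- exact: (double_circ ids).
Qed.

Lemma contains_subalgebras_of_double_identities (m b c : double_op A A^*) :
  identities m b c -> contains_subalgebras m c mA cA mA' cA'.
Proof.
move=> ids; split.
- exact: (double_mA ids).
- exact: (double_cA ids).
- exact: (double_mB ids).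
- exact: (double_cB ids).
Qed.

Lemma ex_Manin_triple_of_double_identities (m b c : double_op A A^*) :
  transposed_Poisson m b -> anti_pre_Lie_Poisson m c -> commutator c = b ->
  identities m b c ->
  exists m b c : double_op A A^*,
  [/\ manin m b, Bd_compatible m b c
    & contains_subalgebras m c mA cA mA' cA'].
Proof.
move=> tp aplp cb ids; exists m, b, c; split.
- exact: Manin_triple_of_double_identities tp ids.
- exact: Bd_compatible_of_double_identities aplp cb ids.
- exact: contains_subalgebras_of_double_identities ids.
Qed.

Lemma Manin_triple_of_double_structure : double ->
  exists m b c : double_op A A^*,
  [/\ manin m b, Bd_compatible m b c
    & contains_subalgebras m c mA cA mA' cA'].
Proof.
intros [m [b [c [tp aplp cb ids]]]].
exact: (ex_Manin_triple_of_double_identities tp aplp cb ids).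
Qed.

End DualDouble.

Theorem theorem3p27 (K : closedFieldType) (charK0 : [pchar K] =i pred0)
    (A : vectType K)
    (mA cA : action A A)
    (mA' cA' : action 'Hom(A, K^o) 'Hom(A, K^o))
    (aplpA : anti_pre_Lie_Poisson mA cA)
    (aplpA' : anti_pre_Lie_Poisson mA' cA') :
  let bA := commutator cA in
  let bA' := commutator cA' in
  let cond1 :=
    exists (m b c : action (A * 'Hom(A, K^o))%type (A * 'Hom(A, K^o))%type),
      [/\ transposed_Poisson_Manin_triple m b mA bA mA' bA',
          Bd_compatible m b c
        & contains_subalgebras m c mA cA mA' cA'] in
  let cond2 :=
    anti_pre_Lie_Poisson_matched_pair mA cA mA' cA'
      (- dual_action mA) (- dual_action bA) (dual_action (rmult cA))
      (- predual_action mA') (- predual_action bA')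
      (predual_action (rmult cA')) in
  let cond3 :=
    transposed_Poisson_matched_pair mA bA mA' bA'
      (- dual_action mA) (- dual_action cA)
      (- predual_action mA') (- predual_action cA') in
  (cond1 <-> cond2) /\ (cond2 <-> cond3).
Proof.
move=> bA bA' cond1 cond2 cond3.
(* Evaluation of functionals satisfies what was assumed of the abstract pairing, and the dual and
   predual actions satisfy the adjunction formulas, so the equivalences apply with the dual space as
   B. *)
have BdE u v : @Bd K A u v = v.2 u.1 + u.2 v.1 by [].
have prDl (a b : 'Hom(A, K^o)) x : (a + b) x = a x + b x by rewrite add_lfunE.
have prDr (a : 'Hom(A, K^o)) x y : a (x + y) = a x + a y by rewrite linearD.
have pr_injl (a b : 'Hom(A, K^o)) : (forall x, a x = b x) -> a = b.
  by move=> E; apply/lfunP.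
have pr_injr (x y : A) : (forall a : 'Hom(A, K^o), a x = a y) -> x = y.
  exact: functional_separation.
have pr_rA x (a : 'Hom(A, K^o)) y :
    dual_action (rmult cA) x a y = - a (cA y x).
  by rewrite dual_actionE rmultE.
have pr_rB b x (a : 'Hom(A, K^o)) :
    a (predual_action (rmult cA') b x) = - cA' a b x.
  by rewrite predual_actionE rmultE.
have pr_muA := opp_dualE mA; have pr_lA := opp_dualE (commutator cA).
have pr_muB := opp_predualE mA'; have pr_lB := opp_predualE (commutator cA').
have pr_rhoA := opp_dualE cA; have pr_rhoB := opp_predualE cA'.
have [E12 E23] := double_equivalences BdE charK0 prDl prDr pr_injl pr_injr
  pr_muA pr_muB pr_lA pr_lB pr_rA pr_rB pr_rhoA pr_rhoB aplpA aplpA'.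
split; last exact: E23.
apply: (iff_trans _ E12).
split.
  intros [m [b [c [triple compat sub]]]].
  exact: double_structure_of_Manin_triple triple compat sub.
exact: Manin_triple_of_double_structure.
Qed.
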